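(* No randomized strategyproof mechanism for locating an obnoxious facility on $[0,1]$ can achieve an approximation ratio better than $$r=\left(\frac{4(3^p+1)}{3(3^p+1)+2}\right)^{1/p}$$ for the $L_p$ social utility, for any finite $p>0$. No randomized strategyproof mechanism can achieve an approximation ratio better than $\frac65$ for the $L_\infty$ social utility.
   Context: Agents $i=1,\dots,n$ have private locations $x_i\in[0,1]$. A randomized mechanism $f$ maps each reported profile $\mathbf x$ to a probability distribution $f(\mathbf x)$ over $[0,1]$. Agent $i$'s utility from a distribution $\pi$ is $\mathbb E_{y\sim\pi}|x_i-y|$. $f$ is strategyproof if no agent can increase its expected utility by misreporting its location, holding others' reports fixed. $L_p$ social utility: $\mathrm{su}_p(y,\mathbf x)=(\sum_i|x_i-y|^p)^{1/p}$ for finite $p>0$ and $\mathrm{su}_\infty(y,\mathbf x)=\max_i|x_i-y|$; the mechanism's value is $\mathbb E_{y\sim f(\mathbf x)}[\mathrm{su}_p(y,\mathbf x)]$. Approximation ratio: the supremum over all numbers of agents and all profiles $\mathbf x$ of $\max_{z\in[0,1]}\mathrm{su}_p(z,\mathbf x)/\mathbb E_{y\sim f(\mathbf x)}[\mathrm{su}_p(y,\mathbf x)]$. *)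

(* Defs.v *)
From HB Require Import structures.
From mathcomp Require Import all_boot all_order all_algebra.
From mathcomp Require Import all_classical all_reals all_analysis.
Set Implicit Arguments. Unset Strict Implicit. Unset Printing Implicit Defensive.
Import Order.TTheory GRing.Theory Num.Theory.
Import numFieldNormedType.Exports.
Local Open Scope classical_set_scope.
Local Open Scope ring_scope.

Section Obnoxious.
Variable R : realType.

Definition in01 (n : nat) (x : 'I_n -> R) : Prop := forall i, 0 <= x i <= 1.

Definition mechanism := forall n : nat, ('I_n -> R) -> probability R R.

Definition Ex (P : probability R R) (g : R -> R) : \bar R := (\int[P]_y (g y)%:E)%E.

Definition supported01 (f : mechanism) : Prop :=
  forall n (x : 'I_n -> R), in01 x -> f n x `[0, 1]%classic = 1%E.

Definition upd n (x : 'I_n -> R) (i : 'I_n) (v : R) : 'I_n -> R :=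
  fun j => if j == i then v else x j.

Definition strategyproof (f : mechanism) : Prop :=
  forall n (x : 'I_n -> R) (i : 'I_n) (v : R), in01 x -> 0 <= v <= 1 ->
    (Ex (f n (upd x i v)) (fun y => `|x i - y|%R) <= Ex (f n x) (fun y => `|x i - y|%R))%E.

Definition su_p (p : R) n (y : R) (x : 'I_n -> R) : R :=
  (\sum_(i < n) `|x i - y| `^ p) `^ p^-1.

Definition su_inf n (y : R) (x : 'I_n -> R) : R :=
  \big[Num.max/0]_(i < n) `|x i - y|.

(* Optimal social utility: max (= sup, attained) over z in [0,1]. *)
Definition opt (su : R -> R) : R := sup [set su z | z in `[0, 1]%classic].

(* "The approximation ratio of f is at least r" for the social utility su:
   for every c < r, some profile has OPT > c * E[su] (i.e. ratio > c,
   with ratio = +oo when the expected value is 0). *)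
Definition ratio_at_least (f : mechanism)
    (su : forall n, R -> ('I_n -> R) -> R) (r : R) : Prop :=
  forall c : R, c < r ->
    exists n (x : 'I_n -> R), in01 x /\
      (c%:E * Ex (f n x) (fun y => su n y x) < (opt (fun z => su n z x))%:E)%E.

Definition lb_p (p : R) : R :=
  (4 * (3 `^ p + 1) / (3 * (3 `^ p + 1) + 2)) `^ p^-1.

End Obnoxious.

(* Main.v *)
Require Import Defs.
From HB Require Import structures.
From mathcomp Require Import all_boot all_order all_algebra.
From mathcomp Require Import all_classical all_reals all_analysis.
From mathcomp Require Import measurable_realfun ring lra.
Import Order.TTheory GRing.Theory Num.Theory.
Import numFieldNormedType.Exports.
Local Open Scope ring_scope.

(** Place agents symmetrically at [a] and [1 - a] with [a <= 1/2]. For every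
   facility location the utilities at these two points sum to at most [1], so
   one of them, say that at [a], is at most [1/2] in expectation.  By
   strategyproofness [E|a - y| <= 1/2] still holds after one agent at [a]
   reports [0]; in the new profile the optimum [y = 1] is far from [a], so the
   mechanism loses a constant factor.  If the social utility is dominated on
   [[0, 1]] by an affine function [b + s |a - y|], its expectation is at most
   [b + s / 2].

   For [p >= 1] and for [p = oo] the final profile is [(0, 2/3)] with
   [a = 1/3]: the [p]-th power of the utility lies below its chord by convexity,
   and concavity of the [p]-th root linearizes the rest.

   For [p < 1] the [p]-th root is convex and that argument breaks down.  There
   the final profile is [(0, 8, 17, 17) / 25], which gives the constant
   [29/25 >= lb_p p]; the affine bound comes from Jensen's inequality, comparing
   the distances to [y] with suitable permutations of the distances
   [(25, 17, 8, 8) / 25] to the optimum [y = 1]. *)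

(** * Expectations of functions on [0, 1] *)

Lemma Ex_le (R : realType) (P : probability R R) (g h : R -> R) :
  P `[0, 1]%classic = 1%E ->
  measurable_fun setT g -> measurable_fun setT h ->
  (forall y, 0 <= g y) -> (forall y, 0 <= h y) ->
  (forall y, 0 <= y <= 1 -> g y <= h y) -> (Ex P g <= Ex P h)%E.
Proof.
move=> P01 mg mh g0 h0 gh; rewrite /Ex; apply: ae_ge0_le_integral => //.
- by move=> y _; rewrite lee_fin.
- exact/measurable_EFinP.
- by move=> y _; rewrite lee_fin.
- exact/measurable_EFinP.
(* The comparison can fail only outside [0, 1], which is a null set. *)
- exists (~` `[0, 1])%classic; split.
  + exact: measurableC.
  + transitivity (1 - P `[0%R, 1%R]%classic)%E; first exact: probability_setC.
    by rewrite P01 subee.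
  + move=> y /= ngh; rewrite in_itv /= => y01; apply: ngh => _.
    by rewrite lee_fin gh.
Qed.

Lemma ExD (R : realType) (P : probability R R) (g h : R -> R) :
  measurable_fun setT g -> measurable_fun setT h ->
  (forall y, 0 <= g y) -> (forall y, 0 <= h y) ->
  (Ex P (fun y => (g y + h y)%R) = Ex P g + Ex P h)%E.
Proof.
move=> mg mh g0 h0; rewrite /Ex -ge0_integralD//.
- by move=> y _; rewrite lee_fin.
- exact/measurable_EFinP.
- by move=> y _; rewrite lee_fin.
- exact/measurable_EFinP.
Qed.

Lemma Ex_cst (R : realType) (P : probability R R) (b : R) :
  Ex P (fun=> b) = b%:E.
Proof.
rewrite /Ex integral_cst// [X in (_ * X)%E](_ : _ = 1%E) ?mule1//.
exact: probability_setT.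
Qed.

Lemma ExZ (R : realType) (P : probability R R) (s : R) (g : R -> R) :
  measurable_fun setT g -> (forall y, 0 <= g y) -> 0 <= s ->
  (Ex P (fun y => (s * g y)%R) = s%:E * Ex P g)%E.
Proof.
move=> mg g0 s0; rewrite /Ex -ge0_integralZl//.
- exact/measurable_EFinP.
- by move=> y _; rewrite lee_fin.
Qed.

Lemma measurable_dist (R : realType) (a : R) :
  measurable_fun setT (fun y : R => `|a - y|).
Proof.
by apply: measurableT_comp => //; apply: measurable_funB.
Qed.

(** * From an affine bound to an approximation ratio *)

Section RatioFromAffineBound.
Variables (R : realType).
Variables (a b s K rho : R).
Hypotheses (a01 : 0 <= a <= 1 / 2) (b0 : 0 <= b) (s0 : 0 <= s) (K0 : 0 < K).
Hypothesis bsK : rho * (b + s / 2) <= K.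

Lemma ratio_from_affine_bound (P : probability R R) (z0 e : R) (g : R -> R) c :
  P `[0, 1]%classic = 1%E ->
  measurable_fun setT g -> (forall y, 0 <= g y) -> 0 <= e <= 1 ->
  (forall y, 0 <= y <= 1 -> g y <= b + s * `|e - y|) ->
  (Ex P (fun y => `|e - y|%R) <= (1 / 2)%:E)%E ->
  0 <= z0 <= 1 -> g z0 = K -> c < rho ->
  (c%:E * Ex P g < (opt g)%:E)%E.
Proof.
move=> P01 mg g0 e01 gb Pe z01 gz c_rho.
have Kopt : K <= opt g.
  rewrite -gz; apply: ub_le_sup; last by exists z0 => //=; rewrite in_itv.
  exists (b + s) => v [y] /=; rewrite in_itv /= => y01 <-.
  apply: (le_trans (gb _ y01)); rewrite lerD2l ler_piMr//.
  move: y01 e01 => /andP[y0 y1] /andP[e0 e1].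
  by rewrite ler_norml; apply/andP; split; lra.
have Eg : (Ex P g <= (b + s / 2)%:E)%E.
  have md := @measurable_dist R e.
  apply: (@le_trans _ _ (Ex P (fun y => b + s * `|e - y|))).
    apply: Ex_le => // [|y].
      by apply: measurable_funD => //; apply: measurable_funM.
    by rewrite addr_ge0// mulr_ge0.
  rewrite ExD//; last 2 first.
    by apply: measurable_funM.
    by move=> y; rewrite mulr_ge0.
  rewrite Ex_cst ExZ// EFinD leeD2l//.
  apply: (@le_trans _ _ (s%:E * (1 / 2)%:E)%E); first exact: lee_wpmul2l.
  by rewrite -EFinM lee_fin; lra.
have Eg0 : (0 <= Ex P g)%E by apply: integral_ge0 => y _; rewrite lee_fin.
have [c0|c0] := leP c 0.
  apply: (@le_lt_trans _ _ 0%E); last by rewrite lte_fin (lt_le_trans K0).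
  by rewrite mule_le0_ge0// lee_fin.
apply: (@le_lt_trans _ _ (c%:E * (b + s / 2)%:E)%E).
  by apply: lee_wpmul2l => //; rewrite lee_fin ltW.
rewrite -EFinM lte_fin; apply: lt_le_trans Kopt.
have [bs0|bs0] := leP (b + s / 2) 0.
  by apply: le_lt_trans K0; rewrite pmulr_rle0.
by apply: lt_le_trans bsK; rewrite ltr_pM2r.
Qed.

(** The two deviations are mirror images. If the expected distance to [a] is at most 1/2, agent [i]
    reports 0 and the point 1 shows that the optimum is at least [K]; otherwise the expected
    distance to [1 - a] is at most 1/2, agent [j] reports 1 and the point 0 plays that part. *)
Lemma ratio_at_least_of_affine_bound (f : mechanism R)
    (su : forall n, R -> ('I_n -> R) -> R) n (x : 'I_n -> R) i j :
  supported01 f -> strategyproof f -> in01 x -> x i = a -> x j = 1 - a ->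
  (forall z, measurable_fun setT (fun y => su n y z)) ->
  (forall y z, 0 <= su n y z) ->
  su n 1 (upd x i 0) = K -> su n 0 (upd x j 1) = K ->
  (forall y, 0 <= y <= 1 -> su n y (upd x i 0) <= b + s * `|a - y|) ->
  (forall y, 0 <= y <= 1 -> su n y (upd x j 1) <= b + s * `|1 - a - y|) ->
  ratio_at_least f su rho.
Proof.
move=> f01 SP x01 xi xj msu su0 Ki Kj bi bj c c_rho.
have upd01 k v : 0 <= v <= 1 -> in01 (upd x k v).
  by move=> v01 l; rewrite /upd; case: ifP.
have usum : (Ex (f n x) (fun y => `|a - y|%R) +
             Ex (f n x) (fun y => `|1 - a - y|%R) <= 1)%E.
  rewrite -ExD//; [|exact: measurable_dist..].
  rewrite -(Ex_cst _ (f n x) 1); apply: Ex_le => //.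
  - exact: f01.
  - by apply: measurable_funD; exact: measurable_dist.
  - move=> y y01; move: y01 a01 => /andP[y0 y1] /andP[a0 a1].
    by case: (ler0P (a - y)); case: (ler0P (1 - a - y)); lra.
have [Ea|Ea] := leP (Ex (f n x) (fun y => `|a - y|%R)) (1 / 2)%:E.
  have v01 : 0 <= (0 : R) <= 1 by rewrite lexx ler01.
  exists n, (upd x i 0); split; first exact: upd01.
  apply: (@ratio_from_affine_bound _ 1 a) => //.
  - exact/f01/upd01.
  - by move: a01 => /andP[? ?]; apply/andP; split; lra.
  - by have := SP n x i 0 x01 v01; rewrite xi => /le_trans; apply.
  - by rewrite lexx ler01.
have v01 : 0 <= (1 : R) <= 1 by rewrite lexx ler01.
exists n, (upd x j 1); split; first exact: upd01.
apply: (@ratio_from_affine_bound _ 0 (1 - a)) => //.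
- exact/f01/upd01.
- by move: a01 => /andP[? ?]; apply/andP; split; lra.
- have := SP n x j 1 x01 v01; rewrite xj => /le_trans; apply.
  rewrite leNgt; apply/negP => Eb.
  move: usum; rewrite leNgt => /negP; apply.
  have -> : 1%E = ((1 / 2)%:E + (1 / 2)%:E : \bar R)%E.
    by rewrite -EFinD; congr EFin; lra.
  exact: lteD.
- by rewrite lexx ler01.
Qed.

End RatioFromAffineBound.

(** * Elementary inequalities and the comparison of [lb_p] with 29/25 *)

Lemma powRVK (R : realType) (a p : R) : 0 <= a -> 0 < p -> (a `^ p) `^ p^-1 = a.
Proof. by move=> a0 p0; rewrite -powRrM divff ?gt_eqF// powRr1. Qed.

(** Young's inequality for x^p and 1, with conjugate exponents 1/p and 1/(1 - p). *)
Lemma powR_le_tangent1 (R : realType) (x p : R) :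
  0 <= x -> 0 < p <= 1 -> x `^ p <= 1 + p * (x - 1).
Proof.
move=> x0 /andP[p0]; rewrite le_eqVlt => /predU1P[->|p1].
  by rewrite powRr1//; lra.
have p10 : 0 < 1 - p by lra.
have -> : 1 + p * (x - 1) = p * x + (1 - p) by ring.
have := @conjugate_powR R (x `^ p) 1 p^-1 (1 - p)^-1 (powR_ge0 _ _) ler01.
rewrite mulr1 powR1 -powRrM divff ?gt_eqF// powRr1// !invrK mul1r => h.
rewrite [p * x]mulrC; apply: h; rewrite ?invr_gt0//; lra.
Qed.

Lemma expR_ge_taylor2 (R : realType) (t : R) :
  0 <= t -> 1 + t + t ^+ 2 / 2 <= expR t.
Proof.
move=> t0; pose h : R -> R := fun u : R => expR u - (1 + u + u ^+ 2 / 2) : R.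
have dh (u : R) : is_derive u 1 h (expR u - (1 + u)).
  rewrite /h; apply: is_derive_eq.
  by rewrite /GRing.scale /=; field.
have hd u : derivable h u 1 by exact: (@ex_derive _ _ _ _ _ _ _ (dh u)).
suff : h 0 <= h t by rewrite /h expR0; lra.
apply: (@ger0_derive1_ndecry R h 0 _ _ _ 0 t (lexx 0) t0).
- by move=> u _.
- move=> u _; rewrite derive1E (@derive_val _ _ _ _ _ _ _ (dh u)).
  by rewrite subr_ge0 expR_ge1Dx.
- by apply: derivable_within_continuous => u _.
Qed.

(** The difference of the two sides vanishes at 0 and has derivative 1 - e^u (1 - u), nonnegative
    because 1 - u <= e^(-u). *)
Lemma expR_le_pade (R : realType) (t : R) : 0 <= t -> expR t * (2 - t) <= 2 + t.
Proof.
move=> t0.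
pose h : R -> R := fun u : R => 2 + u - expR u * (2 - u) : R.
have dh (u : R) : is_derive u 1 h (1 - expR u * (1 - u)).
  rewrite /h; apply: is_derive_eq.
  by rewrite /GRing.scale /=; ring.
suff : h 0 <= h t by rewrite /h expR0; lra.
have hd u : derivable h u 1 by exact: (@ex_derive _ _ _ _ _ _ _ (dh u)).
apply: (@ger0_derive1_ndecry R h 0 _ _ _ 0 t (lexx 0) t0).
- by move=> u _.
- move=> u _; rewrite derive1E (@derive_val _ _ _ _ _ _ _ (dh u)).
  rewrite subr_ge0.
  have := expR_ge1Dx (- u); rewrite expRN => hu.
  have e0 := expR_gt0 u.
  by rewrite mulrC -ler_pdivlMr// mul1r.
- by apply: derivable_within_continuous => u _.
Qed.

Lemma three_le_expR (R : realType) : 3 <= expR (32 / 29) :> R.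
Proof.
have sq (q r t : R) : q <= expR t -> 0 <= q -> r <= q ^+ 2 -> r <= expR (t + t).
  move=> qt q0 rq; apply: (le_trans rq); rewrite expRD expr2.
  by apply: ler_pM.
(* The Taylor bound at 4/29 is squared three times to reach 32/29, each value being rounded down to
   a simple fraction. *)
have h : 109 / 95 <= expR (4 / 29) :> R.
  by have := @expR_ge_taylor2 R (4 / 29); lra.
have {}h := sq _ (129 / 98) _ h ltac:(lra) ltac:(lra).
have {}h := sq _ (97 / 56) _ h ltac:(lra) ltac:(lra).
have {}h := sq _ 3 _ h ltac:(lra) ltac:(lra).
by apply: (le_trans h); rewrite ler_expR; lra.
Qed.

Lemma lb_p_le (R : realType) (p : R) : 0 < p <= 1 -> lb_p p <= 29 / 25.
Proof.
move=> /andP[p0 p1].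
set A := 3 `^ p + 1.
have A0 : 0 < 3 `^ p :> R by rewrite powR_gt0.
(* Since [(29/25)^p >= 1 / (1 - 4p/29)] by Bernoulli, it suffices to show
   [3^p <= (1 + 16p/29) / (1 - 16p/29)]. *)
have h3 : 3 `^ p * (1 - 16 * p / 29) <= 1 + 16 * p / 29.
  have h1 : 3 `^ p <= expR (32 * p / 29).
    have -> : 32 * p / 29 = 32 / 29 * p by lra.
    rewrite expRM; apply: ge0_ler_powR; rewrite ?nnegrE ?expR_ge0//; first lra.
    exact: three_le_expR.
  have := @expR_le_pade R (32 * p / 29) ltac:(lra).
  have : 3 `^ p * (1 - 16 * p / 29) <= expR (32 * p / 29) * (1 - 16 * p / 29).
    by rewrite ler_wpM2r//; lra.
  lra.
have hB : (25 / 29) `^ p <= 1 - 4 * p / 29 :> R.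
  by have := @powR_le_tangent1 R (25 / 29) p ltac:(lra) ltac:(lra); lra.
have B0 : 0 < (25 / 29) `^ p :> R by rewrite powR_gt0; lra.
have key : 4 * A / (3 * A + 2) <= (29 / 25) `^ p.
  have YB : (29 / 25) `^ p * (25 / 29) `^ p = 1 :> R.
    rewrite -powRM; [|lra..].
    by have -> : 29 / 25 * (25 / 29) = 1 :> R; [lra | rewrite powR1].
  rewrite -(ler_pM2r B0) YB mulrAC ler_pdivrMr ?mul1r; last by rewrite /A; lra.
  (* As A = 3^p + 1, the inequality 4A (1 - 4p/29) <= 3A + 2 is a rearrangement of [h3]. *)
  apply: (@le_trans _ _ (4 * A * (1 - 4 * p / 29))).
    by rewrite ler_wpM2l// /A; lra.
  by rewrite /A; lra.
rewrite /lb_p -/A.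
have -> : 29 / 25 = ((29 / 25) `^ p) `^ p^-1 :> R.
  by rewrite powRVK//; lra.
apply: ge0_ler_powR => //; rewrite ?nnegrE ?powR_ge0 ?invr_ge0 ?ltW//.
by apply: divr_gt0; rewrite /A; lra.
Qed.

(** * Formulas and estimates for the social utilities *)

Lemma measurable_su_p (R : realType) (p : R) n (x : 'I_n -> R) :
  measurable_fun setT (fun y => su_p p y x).
Proof.
have mp := @measurable_powR R p.
apply: (measurableT_comp (measurable_powR p^-1)).
apply: measurable_sum => i.
exact: (measurableT_comp mp (measurable_dist _ _)).
Qed.

Lemma su_inf2 (R : realType) (y : R) (x : 'I_2 -> R) :
  su_inf y x = Num.max `|x ord0 - y| `|x ord_max - y|.
Proof.
rewrite /su_inf 2!big_ord_recl big_ord0 (max_l (normr_ge0 _)).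
by congr (Num.max _ `|x _ - y|); apply/val_inj.
Qed.

Lemma measurable_su_inf2 (R : realType) (x : 'I_2 -> R) :
  measurable_fun setT (fun y => su_inf y x).
Proof.
under eq_fun do rewrite su_inf2.
by apply: measurable_maxr; exact: measurable_dist.
Qed.

(* Jensen's inequality for the ratios [d i / e i] with weights [e i `^ p]. *)
Lemma powR_sum_le (R : realType) (p l : R) n (d e : 'I_n -> R) :
  0 < p <= 1 -> 0 < l -> (forall i, 0 <= d i) -> (forall i, 0 < e i) ->
  \sum_(i < n) e i `^ p * (d i / e i) <= l * (\sum_(i < n) e i `^ p) ->
  (\sum_(i < n) d i `^ p) `^ p^-1 <= l * (\sum_(i < n) e i `^ p) `^ p^-1.
Proof.
move=> p01 l0 d0 e0 del; have /andP[p0 p1] := p01.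
have S0 : 0 <= \sum_(i < n) e i `^ p by apply: sumr_ge0 => i _; exact: powR_ge0.
have lp : 0 < l `^ p by rewrite powR_gt0.
rewrite -[l in leRHS](powRVK _ l p (ltW l0) p0).
rewrite -powRM ?powR_ge0//.
apply: ge0_ler_powR; rewrite ?nnegrE ?invr_ge0 ?mulr_ge0 ?powR_ge0 ?(ltW p0)//.
  by apply: sumr_ge0 => i _; exact: powR_ge0.
(* The tangent bound at d_i / (l e_i), multiplied by (l e_i)^p; after summation the hypothesis
   controls the linear term. *)
have step i : d i `^ p <=
    l `^ p * ((1 - p) * e i `^ p + p / l * (e i `^ p * (d i / e i))).
  have -> : (1 - p) * e i `^ p + p / l * (e i `^ p * (d i / e i)) =
      e i `^ p * (1 + p * (d i / (l * e i) - 1)).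
    by field; rewrite !gt_eqF.
  rewrite mulrA -powRM ?(ltW l0) ?(ltW (e0 i))//.
  rewrite [in leLHS](_ : d i = l * e i * (d i / (l * e i))); last first.
    by rewrite mulrC divfK// gt_eqF// mulr_gt0.
  have q0 : 0 <= d i / (l * e i) by rewrite divr_ge0// ltW// mulr_gt0.
  rewrite [leLHS]powRM//; last by rewrite mulr_ge0// ltW.
  by apply: ler_wpM2l; [exact: powR_ge0 | exact: powR_le_tangent1].
apply: (le_trans (ler_sum _ (fun i _ => step i))).
rewrite -mulr_sumr ler_pM2l// big_split /= -!mulr_sumr.
apply: (@le_trans _ _ ((1 - p) * (\sum_(i < n) e i `^ p) +
    p / l * (l * (\sum_(i < n) e i `^ p)))).
  by rewrite lerD2l ler_wpM2l// divr_ge0// ltW.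
by rewrite mulrA divfK ?gt_eqF// -mulrDl subrK mul1r.
Qed.

Lemma su_p2 (R : realType) (p y : R) (x : 'I_2 -> R) :
  su_p p y x = (`|x ord0 - y| `^ p + `|x ord_max - y| `^ p) `^ p^-1.
Proof.
rewrite /su_p 2!big_ord_recl big_ord0 addr0.
by congr ((_ + `|x _ - y| `^ p) `^ _); apply/val_inj.
Qed.

(** * Two agents: the profile and the case p = oo *)

Definition thirds (R : realType) : 'I_2 -> R :=
  fun i => if i == ord0 then 1 / 3 else 2 / 3.

Lemma in01_thirds (R : realType) : in01 (thirds R).
Proof. by move=> i; rewrite /thirds; case: ifP => _; apply/andP; split; lra. Qed.

Lemma ratio_su_inf (R : realType) (f : mechanism R) :
  supported01 f -> strategyproof f -> ratio_at_least f (@su_inf R) (6 / 5).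
Proof.
move=> f01 SP.
(* Since 1/3 is the midpoint of 0 and 2/3, the farther of them is at half their gap plus the
   distance from y to 1/3. The expectation is thus at most 1/3 + 1/2 = 5/6, against an optimum of
   1. *)
have inf_bound (y : R) : 0 <= y <= 1 ->
    Num.max `|0 - y| `|2 / 3 - y| = 1 / 3 + 1 * `|1 / 3 - y|.
  move=> /andP[y0 y1]; rewrite sub0r normrN ger0_norm//.
  by case: (ler0P (2 / 3 - y)); case: (ler0P (1 / 3 - y)) => ? ?;
    [rewrite max_l|rewrite max_l|rewrite max_l|rewrite max_r]; lra.
apply: (@ratio_at_least_of_affine_bound R (1 / 3) (1 / 3) 1 1 (6 / 5)
    _ _ _ _ _ f (@su_inf R) 2 (thirds R) ord0 ord_max) => //; try lra.
- exact: in01_thirds.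
- by rewrite /thirds /=; lra.
- exact: measurable_su_inf2.
- by move=> y z; rewrite su_inf2 le_max normr_ge0.
- by rewrite su_inf2 /upd /thirds /= inf_bound ?lexx ?ler01//; rewrite ler0_norm; lra.
- rewrite su_inf2 /upd /thirds /= subr0 subr0 normr1 max_r//.
  by rewrite ger0_norm; lra.
- by move=> y y01; rewrite su_inf2 /upd /thirds /= inf_bound.
(* The reflection y -> 1 - y turns (1/3, 1) into (0, 2/3), up to the order of the agents. *)
- move=> y y01; rewrite su_inf2 /upd /thirds /= maxC.
  have := inf_bound (1 - y).
  have -> : `|0 - (1 - y)| = `|1 - y| by rewrite sub0r normrN.
  have -> : `|2 / 3 - (1 - y)| = `|1 / 3 - y|.
    by rewrite -normrN; congr `|_|; lra.
  have -> : `|1 / 3 - (1 - y)| = `|1 - 1 / 3 - y|.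
    by rewrite -normrN; congr `|_|; lra.
  by move=> ->//; lra.
Qed.

(** * Two agents: the case p >= 1 *)

Lemma powR_chord (R : realType) (p t : R) : 1 <= p -> 0 <= t <= 2 ->
  (1 + t) `^ p + `|1 - t| `^ p <= 2 + t / 2 * (3 `^ p - 1).
Proof.
move=> p1 /andP[t0 t2].
have h1 : `|1 - t| `^ p <= 1.
  rewrite [leRHS](_ : 1 = 1 `^ p); last by rewrite powR1.
  apply: ge0_ler_powR; rewrite ?nnegrE//; first lra.
  by rewrite ler_norml; apply/andP; split; lra.
have l0 : 0 <= t / 2 by lra.
have l1 : t / 2 <= 1 by lra.
(* Convexity at 1 + t as a point of [1, 3]; together with [h1] the bound is exact at t = 0 and t =
   2. *)
have h : (t / 2 * 3 + (1 - t / 2) * 1) `^ p <=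
    t / 2 * 3 `^ p + (1 - t / 2) * 1 `^ p.
  by apply: (@convex_powR R p p1 (Itv01 l0 l1) 3 1);
    rewrite inE /= in_itv /= andbT.
by move: h; rewrite powR1 (_ : _ * 3 + _ = 1 + t); lra.
Qed.

Section LpGe1.
Variables (R : realType) (p : R).
Hypothesis p1 : 1 <= p.

Let A : R := 3 `^ p + 1.
Let u : R := (1 / 3) `^ p.
(* Value at [|1 / 3 - y| = 1 / 2] of the chord bounding
   [`|0 - y| `^ p + `|2 / 3 - y| `^ p]; the affine bound below comes from the
   tangent of [x |-> x `^ p^-1] at [S0]. *)
Let S0 : R := u * (3 * A + 2) / 4.

Let p0 : 0 < p. Proof. by apply: lt_le_trans p1. Qed.

Let q01 : 0 < p^-1 <= 1.
Proof. by rewrite invr_gt0 p0 invf_le1. Qed.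

Let A2 : 2 <= A.
Proof.
rewrite /A; have := @ler_powR R 3 ltac:(lra) 0 p (ltW p0).
by rewrite powRr0; lra.
Qed.

Let u0 : 0 < u. Proof. by apply: powR_gt0; lra. Qed.

Let S00 : 0 < S0. 
Proof. by rewrite /S0 divr_gt0// mulr_gt0//; have := A2; lra. Qed.

(** With t = 3 |1/3 - y|, the distances from y to 0 and 2/3 are (1 + t)/3 and |1 - t|/3 in some
    order. The chord bounds the sum of their p-th powers, and the tangent of x^(1/p) at [S0] lies
    above that concave function. *)
Lemma su_thirds_le (y : R) : 0 <= y <= 1 ->
  (`|0 - y| `^ p + `|2 / 3 - y| `^ p) `^ p^-1 <=
  S0 `^ p^-1 * (1 + p^-1 * (2 * u / S0 - 1)) +
  S0 `^ p^-1 * (3 / 2 * p^-1 * (u * (A - 2)) / S0) * `|1 / 3 - y|.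
Proof.
move=> /andP[y0 y1].
have [t [t02 tE ->]] : exists t, [/\ 0 <= t <= 2, t = 3 * `|1 / 3 - y| &
   `|0 - y| `^ p + `|2 / 3 - y| `^ p = u * ((1 + t) `^ p + `|1 - t| `^ p)].
  have third (z : R) : 0 <= z -> u * z `^ p = (z / 3) `^ p.
    move=> z0; have -> : z / 3 = 1 / 3 * z by lra.
    by rewrite powRM//; lra.
  exists (3 * `|1 / 3 - y|); split => //.
    by case: (ler0P (1 / 3 - y)); lra.
  rewrite sub0r normrN (ger0_norm y0) mulrDr.
  case: (ler0P (1 / 3 - y)) => h; rewrite !third//; try lra.
    congr (_ `^ p + _ `^ p); first lra.
    by case: (ler0P (2 / 3 - y)) => ?; case: ler0P; lra.
  rewrite addrC; congr (_ `^ p + _ `^ p); last first.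
    by case: ler0P; lra.
  by case: (ler0P (2 / 3 - y)) => ?; lra.
have t0 : 0 <= t by move/andP: t02 => [].
have chord := powR_chord _ _ _ p1 t02.
have -> : `|1 / 3 - y| = t / 3 by rewrite tE; lra.
set S := u * _.
have SS : S <= u * (2 + t / 2 * (A - 2)).
  by rewrite /S ler_wpM2l ?(ltW u0)// /A; lra.
have SS0 : 0 <= S by rewrite /S mulr_ge0 ?addr_ge0 ?powR_ge0// ltW.
have [q0 q1] := andP q01.
have -> : S = S0 * (S / S0) by rewrite mulrC divfK// gt_eqF.
have SS00 : 0 <= S / S0 := divr_ge0 SS0 (ltW S00).
rewrite (powRM _ (ltW S00) SS00) -(mulrA (S0 `^ _)) -mulrDr ler_wpM2l ?powR_ge0//.
have := @powR_le_tangent1 R (S / S0) p^-1 SS00 q01.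
move=> /le_trans; apply.
rewrite -addrA lerD2l.
have -> : p^-1 * (2 * u / S0 - 1) + 3 / 2 * p^-1 * (u * (A - 2)) / S0 * (t / 3) =
  p^-1 * (u * (2 + t / 2 * (A - 2)) / S0 - 1).
  by field; rewrite !gt_eqF.
by rewrite ler_pM2l// lerD2r ler_pM2r// invr_gt0.
Qed.

Lemma ratio_su_p_ge1 (f : mechanism R) :
  supported01 f -> strategyproof f -> ratio_at_least f (su_p p) (lb_p p).
Proof.
move=> f01 SP; have [q0 q1] := andP q01.
have uA : 1 `^ p + `|2 / 3 - 1| `^ p = u * A.
  rewrite /A mulrDr mulr1 -powRM; [|lra..].
  rewrite ler0_norm; last lra.
  by congr (_ `^ p + _ `^ p); lra.
apply: (@ratio_at_least_of_affine_bound R (1 / 3)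
    (S0 `^ p^-1 * (1 + p^-1 * (2 * u / S0 - 1)))
    (S0 `^ p^-1 * (3 / 2 * p^-1 * (u * (A - 2)) / S0)) ((u * A) `^ p^-1) (lb_p p)
    _ _ _ _ _ f (su_p p) 2 (thirds R) ord0 ord_max) => //.
- by lra.
- rewrite mulr_ge0 ?powR_ge0//.
  have -> : 1 + p^-1 * (2 * u / S0 - 1) = (1 - p^-1) + p^-1 * (2 * u / S0) by ring.
  apply: addr_ge0; first by rewrite subr_ge0.
  apply: mulr_ge0; first exact: ltW.
  by apply: divr_ge0; [apply: mulr_ge0 => //; exact: ltW|exact: ltW].
- rewrite mulr_ge0 ?powR_ge0//; apply: divr_ge0; last exact: ltW.
  apply: mulr_ge0; first by apply: mulr_ge0; [lra|exact: ltW].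
  by apply: mulr_ge0; [exact: ltW|have := A2; lra].
- by rewrite powR_gt0// mulr_gt0//; have := A2; lra.
(* At distance 1/2 the tangent touches, so the affine function equals S0^(1/p) there; since 4A / (3A
   + 2) * S0 = u A, the condition is an equality. *)
- rewrite le_eqVlt; apply/orP; left; apply/eqP.
  have -> : S0 `^ p^-1 * (1 + p^-1 * (2 * u / S0 - 1)) +
    S0 `^ p^-1 * (3 / 2 * p^-1 * (u * (A - 2)) / S0) / 2 = S0 `^ p^-1.
    have E : u * (3 * A + 2) = 4 * S0 by rewrite /S0; lra.
    have -> : S0 `^ p^-1 * (1 + p^-1 * (2 * u / S0 - 1)) +
      S0 `^ p^-1 * (3 / 2 * p^-1 * (u * (A - 2)) / S0) / 2 =
      S0 `^ p^-1 * (1 + p^-1 * ((u * (3 * A + 2)) / (4 * S0) - 1)).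
      by field; rewrite !gt_eqF.
    by rewrite E divff ?subrr ?mulr0 ?addr0 ?mulr1// gt_eqF// mulr_gt0.
  have L0 : 0 <= 4 * A / (3 * A + 2) by apply: divr_ge0; have := A2; lra.
  rewrite /lb_p -/A -(powRM _ L0 (ltW S00)).
  by congr (_ `^ _); rewrite /S0; field; have := A2; lra.
- exact: in01_thirds.
- by rewrite /thirds /=; lra.
- exact: measurable_su_p.
- by move=> y z; exact: powR_ge0.
- by rewrite su_p2 /upd /thirds /= sub0r normrN normr1 uA.
- by rewrite su_p2 /upd /thirds /= !subr0 normr1 addrC -uA; congr ((_ + _ `^ _) `^ _);
    rewrite ger0_norm ?ler0_norm; lra.
- by move=> y y01; rewrite su_p2 /upd /thirds /= su_thirds_le.
- move=> y y01; rewrite su_p2 /upd /thirds /= addrC.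
  have := su_thirds_le (1 - y).
  have -> : `|0 - (1 - y)| = `|1 - y| by rewrite sub0r normrN.
  have -> : `|2 / 3 - (1 - y)| = `|1 / 3 - y|.
    by rewrite -normrN; congr `|_|; lra.
  have -> : `|1 / 3 - (1 - y)| = `|1 - 1 / 3 - y|.
    by rewrite -normrN; congr `|_|; lra.
  by apply; lra.
Qed.

End LpGe1.

(** * Four agents: the case p <= 1 *)

Lemma sum4 (R : realType) (F : 'I_4 -> R) :
  \sum_(i < 4) F i =
  F ord0 + F (inord 1) + F (inord 2) + F ord_max.
Proof.
rewrite 4!big_ord_recl big_ord0 addr0 !addrA.
by congr (_ + F _ + F _ + F _); apply/val_inj; rewrite /= ?inordK.
Qed.

Definition seq4 (R : realType) (a b c d : R) : 'I_4 -> R :=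
  fun i => [:: a; b; c; d]`_i.

Lemma sum4_seq (R : realType) (F : R -> R) (a b c d : R) :
  \sum_(i < 4) F (seq4 R a b c d i) = F a + F b + F c + F d.
Proof. by rewrite sum4 /seq4 /= !inordK. Qed.

Section LpLe1.
Variables (R : realType) (p : R).
Hypothesis p01 : 0 < p <= 1.

Let beta : R := (17 / 25) `^ p.
Let gamma : R := (8 / 25) `^ p.

Let betaP : beta <= 1 - 8 / 25 * p.
Proof.
by have := @powR_le_tangent1 R (17 / 25) p ltac:(lra) p01; rewrite -/beta; lra.
Qed.

(** A lower bound on [gamma] comes from the tangent bound on its inverse (25/8)^p. *)
Let gammaP : 1 <= gamma * (1 + 17 / 8 * p).
Proof.
have g0 : 0 <= gamma by exact: powR_ge0.
have := @powR_le_tangent1 R (25 / 8) p ltac:(lra) p01.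
move=> /(ler_wpM2l g0); rewrite /gamma -powRM; [|lra..].
by rewrite (_ : 8 / 25 * (25 / 8) = 1) ?powR1; lra.
Qed.

Let gamma_beta : gamma <= beta.
Proof.
have /andP[p0 _] := p01.
by apply: ge0_ler_powR; rewrite ?nnegrE ?(ltW p0)//; lra.
Qed.

(* The affine bound at [y = 0]; it is an equality for [p = 1]. *)
Let beta_gamma : 200 * beta <= 32 + 325 * gamma.
Proof.
have /andP[p0 p1] := p01; have h1 := betaP; have h2 := gammaP.
suff : 168 - 64 * p <= 325 * gamma by lra.
rewrite -(@ler_pM2r _ (1 + 17 / 8 * p)); last lra.
apply: (@le_trans _ _ 325); last by lra.
by nra.
Qed.

(** Social utility of the final profile at y = 1, where the distances are 1, 17/25, 8/25, 8/25. *)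
Let K : R := (1 + beta + 2 * gamma) `^ p^-1.

Lemma four_point_le (l d0 d1 d2 d3 e0 e1 e2 e3 : R) : 0 < l ->
  0 <= d0 -> 0 <= d1 -> 0 <= d2 -> 0 <= d3 ->
  0 < e0 -> 0 < e1 -> 0 < e2 -> 0 < e3 ->
  e0 `^ p + e1 `^ p + e2 `^ p + e3 `^ p = 1 + beta + 2 * gamma ->
  e0 `^ p * (d0 / e0) + e1 `^ p * (d1 / e1) + e2 `^ p * (d2 / e2) +
    e3 `^ p * (d3 / e3) <= l * (1 + beta + 2 * gamma) ->
  (d0 `^ p + d1 `^ p + d2 `^ p + d3 `^ p) `^ p^-1 <= l * K.
Proof.
move=> l0 hd0 hd1 hd2 hd3 he0 he1 he2 he3 eE del.
have := @powR_sum_le R p l 4 (seq4 R d0 d1 d2 d3) (seq4 R e0 e1 e2 e3) p01 l0.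
rewrite !(sum4_seq _ (fun x => x `^ p)) eE -/K sum4 /seq4 /= !inordK//=.
apply => //.
- by case=> [[|[|[|[|]]]]].
- by case=> [[|[|[|[|]]]]].
Qed.

(** The factor of [K] is the affine function of |8/25 - y| with values 21/29 at y = 0 and 1 at y =
    1, the exact ratios for p = 1. In Jensen's inequality the reference distance 1 goes to an agent
    farthest from y: one at 17/25 while y <= 17/50, the midpoint of 0 and 17/25, and the agent at 0
    afterwards. *)
Lemma su_four_le (y : R) : 0 <= y <= 1 ->
  (`|0 - y| `^ p + `|8 / 25 - y| `^ p + `|17 / 25 - y| `^ p +
     `|17 / 25 - y| `^ p) `^ p^-1 <=
  K * (125 / 261) + K * (200 / 261) * `|8 / 25 - y|.
Proof.
move=> /andP[y0 y1]; have hbg := beta_gamma; have gb := gamma_beta.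
have g0 : 0 < gamma by apply: powR_gt0; lra.
have b1 : beta <= 1 by have := betaP; have /andP[] := p01; lra.
rewrite -(mulrA K) -mulrDr [leRHS]mulrC.
rewrite sub0r normrN (ger0_norm y0).
have [y8|y8] := leP y (8 / 25).
  rewrite !ger0_norm; try lra.
  apply: (four_point_le _ _ _ _ _ (8 / 25) (8 / 25) 1 (17 / 25));
    rewrite ?powR1 -/gamma -/beta; nra.
have [y17|y17] := leP y (17 / 25).
  rewrite (ler0_norm (_ : 8 / 25 - y <= 0)); last by lra.
  rewrite (ger0_norm (_ : 0 <= 17 / 25 - y)); last by lra.
  (* Neither permutation works on the whole of [[8/25, 17/25]]. *)
  have [yh|yh] := leP y (17 / 50).
    apply: (four_point_le _ _ _ _ _ (8 / 25) (8 / 25) 1 (17 / 25));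
      rewrite ?powR1 -/gamma -/beta; nra.
  apply: (four_point_le _ _ _ _ _ 1 (8 / 25) (17 / 25) (8 / 25));
    rewrite ?powR1 -/gamma -/beta; nra.
rewrite !ler0_norm; try lra.
(* Each agent is compared with its own distance to 1, so the bound is exact at y = 1. *)
apply: (four_point_le _ _ _ _ _ 1 (17 / 25) (8 / 25) (8 / 25));
  rewrite ?powR1 -/gamma -/beta; nra.
Qed.

Lemma ratio_su_p_le1 (f : mechanism R) :
  supported01 f -> strategyproof f -> ratio_at_least f (su_p p) (lb_p p).
Proof.
move=> f01 SP; have /andP[p0 p1] := p01.
have g0 : 0 < gamma by apply: powR_gt0; lra.
have b0 : 0 < beta by apply: powR_gt0; lra.
have K0 : 0 < K by apply: powR_gt0; lra.
have su4 (y a b c d : R) (x : 'I_4 -> R) : x =1 seq4 R a b c d ->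
    su_p p y x = (`|a - y| `^ p + `|b - y| `^ p + `|c - y| `^ p +
      `|d - y| `^ p) `^ p^-1.
  move=> xE; rewrite /su_p -(sum4_seq R (fun z => `|z - y| `^ p)).
  by congr (_ `^ _); apply: eq_bigr => i _; rewrite xE.
pose x := seq4 R (8 / 25) (8 / 25) (17 / 25) (17 / 25).
have xl : upd x ord0 0 =1 seq4 R 0 (8 / 25) (17 / 25) (17 / 25).
  by case=> [[|[|[|[|]]]]].
have xr : upd x ord_max 1 =1 seq4 R (8 / 25) (8 / 25) (17 / 25) 1.
  by case=> [[|[|[|[|]]]]].
have d25 : `|8 / 25 - 1| = 17 / 25 :> R by rewrite ler0_norm; lra.
have d8 : `|17 / 25 - 1| = 8 / 25 :> R by rewrite ler0_norm; lra.
apply: (@ratio_at_least_of_affine_bound R (8 / 25) (K * (125 / 261))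
    (K * (200 / 261)) K (lb_p p) _ _ _ _ _ f (su_p p) 4 x ord0 ord_max) => //.
- by lra.
- by apply: mulr_ge0; lra.
- by apply: mulr_ge0; lra.
(* At distance 1/2 the affine function equals 25/29 times [K], whence the constant 29/25. *)
- have := lb_p_le _ _ p01.
  rewrite (_ : K * (125 / 261) + K * (200 / 261) / 2 = 25 / 29 * K); last by field.
  by move=> h; have := ler_wpM2r (ltW K0) h; lra.
- by case=> [[|[|[|[|]]]]] // ?; rewrite /x /seq4 /=; apply/andP; split; lra.
- by rewrite /x /seq4 /=; lra.
- exact: measurable_su_p.
- by move=> y z; exact: powR_ge0.
- rewrite (su4 _ _ _ _ _ _ xl) d25 d8 sub0r normrN normr1 powR1 /K.
  by congr (_ `^ _); rewrite -/beta -/gamma; ring.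
- rewrite (su4 _ _ _ _ _ _ xr) !subr0 normr1 powR1 !ger0_norm; try lra.
  by rewrite /K; congr (_ `^ _); rewrite -/beta -/gamma; ring.
- by move=> y y01; rewrite (su4 _ _ _ _ _ _ xl) su_four_le.
- move=> y y01; rewrite (su4 _ _ _ _ _ _ xr).
  have := su_four_le (1 - y).
  have -> : `|0 - (1 - y)| = `|1 - y| by rewrite sub0r normrN.
  have -> : `|17 / 25 - (1 - y)| = `|8 / 25 - y|.
    by rewrite -normrN; congr `|_|; lra.
  have -> : `|8 / 25 - (1 - y)| = `|1 - 8 / 25 - y|.
    by rewrite -normrN; congr `|_|; lra.
  rewrite (_ : `|17 / 25 - y| = `|1 - 8 / 25 - y|); last by congr `|_|; lra.
  move=> h; apply: le_trans (h _); last by lra.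
  by rewrite le_eqVlt; apply/orP; left; apply/eqP; congr (_ `^ _); ring.
Qed.

End LpLe1.

Theorem theorem4 (R : realType) :
  (forall p : R, 0 < p ->
     forall f : mechanism R, supported01 f -> strategyproof f ->
       ratio_at_least f (su_p p) (lb_p p)) /\
  (forall f : mechanism R, supported01 f -> strategyproof f ->
       ratio_at_least f (@su_inf R) (6 / 5)).
Proof.
split=> [p p0 f f01 SP|f f01 SP]; last exact: ratio_su_inf.
have [p1|/ltW p1] := leP p 1; last exact: ratio_su_p_ge1.
by apply: ratio_su_p_le1 => //; rewrite p0.
Qed.
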